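(* Let $k$ be a field, let $D$ be an oriented knot diagram with at least one crossing, and let $\tau : (Q_D)_0 \to k\setminus\{0\}$ be a map. Then the algebra of the diagram $\Lambda_{D,\tau}=kQ_D/I_\tau$ is self-injective, in the sense that there exists a non-degenerate $k$-bilinear form $\beta:\Lambda_{D,\tau}\times\Lambda_{D,\tau}\to k$ which is associative, i.e. $\beta(xy,z)=\beta(x,yz)$ for all $x,y,z\in\Lambda_{D,\tau}$.
   Context: Quivers and path algebras. A quiver $Q$ consists of finite sets $Q_0$ (vertices) and $Q_1$ (arrows) and maps $s,t:Q_1\to Q_0$ (source, target); loops and multiple arrows are allowed. The path algebra $kQ$ has as $k$-basis all oriented paths of $Q$, including the trivial (length $0$) paths given by the vertices; the product of two paths is their concatenation if it can be performed and $0$ otherwise. Paths are composed from right to left: $ba$ means first $a$, then $b$, with $t(a)=s(b)$. Self-injective. The convention used here is that a finite dimensional $k$-algebra $\Lambda$ is called self-injective if it admits a non-degenerate associative bilinear form $\Lambda\times\Lambda\to k$. Knot diagrams. An oriented knot diagram $D$ is a regular projection of an oriented knot (one component) to the plane, with finitely many transversal double points (crossings), each with the information of which strand passes over and which passes under. Thus travelling once around $D$ along its orientation, one passes through each crossing exactly twice, once over and once under. A segment of $D$ is the part of the diagram followed, along the orientation, from one passage through a crossing to the next passage through a crossing (no crossing in between). The quiver $Q_D$ ($D$ with at least one crossing). Its vertices are the crossings of $D$. Each segment gives one arrow, from the crossing where the segment starts to the crossing where it ends. The source of an arrow is called positive (resp. negative) if the corresponding segment starts by over-crossing (resp. under-crossing)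 at that crossing; the target of an arrow is called positive (resp. negative) if the segment ends by over-crossing (resp. under-crossing). Cycles at a vertex $e$. $\alpha_e$ is the path from $e$ to $e$ that starts with the arrow with positive source $e$ and continues by browsing the oriented diagram (each arrow followed by the arrow of the next segment along the diagram) until reaching the arrow with negative target $e$. $\beta_e$ is the path from $e$ to $e$ that starts with the arrow with negative source $e$ and continues by browsing the oriented diagram until reaching the arrow with positive target $e$. The ideal $I_\tau$ is the two-sided ideal of $kQ_D$ generated by: (Type I) all paths $ba$ of length $2$ such that, at the middle vertex $e=t(a)=s(b)$, the sign of the target of $a$ differs from the sign of the source of $b$; (Type II) the elements $\alpha_e\beta_e-\tau(e)\,\beta_e\alpha_e$ for all vertices $e$. The algebra of the diagram $D$ with respect to $\tau$ is $\Lambda_{D,\tau}=kQ_D/I_\tau$ (it is finite dimensional over $k$). *)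

(* Defs.v *)
From HB Require Import structures.
From mathcomp Require Import all_boot all_order all_algebra finmap.
From mathcomp Require Import ring_quotient sesquilinear.
From mathcomp Require Import boolp classical_sets reals topology normedtype.
From mathcomp Require Import derive.
From mathcomp Require monalg.
Import -(notations) monalg.

Set Implicit Arguments.
Unset Strict Implicit.
Unset Printing Implicit Defensive.

Import Order.TTheory GRing.Theory Num.Theory numFieldNormedType.Exports.

Local Open Scope classical_set_scope.
Local Open Scope ring_scope.
Local Open Scope quotient_scope.

Section Ideals.
Variable A : pzRingType.
Implicit Types (S J : set A).

Definition two_sided_ideal J : Prop :=
  [/\ J 0, forall x y, J x -> J y -> J (x - y),
      forall a x, J x -> J (a * x) & forall a x, J x -> J (x * a)].

Definition ideal_gen S : set A := smallest two_sided_ideal S.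

Lemma ideal_gen_ideal S : two_sided_ideal (ideal_gen S).
Proof.
split=> [J [[]]|x y Sx Sy J SJ|a x Sx J SJ|a x Sx J SJ] //;
  have [[_ JB JMl JMr] _] := SJ.
- exact: JB (Sx J SJ) (Sy J SJ).
- exact: JMl (Sx J SJ).
- exact: JMr (Sx J SJ).
Qed.

Lemma sub_ideal_gen S : S `<=` ideal_gen S.
Proof. by move=> x Sx J [_]; apply. Qed.

Definition ideal_pred S : A -> bool := fun x => `[< ideal_gen S x >].

Fact ideal_pred_zmod_closed S : zmod_closed (ideal_pred S).
Proof.
have [I0 IB _ _] := ideal_gen_ideal S; split; first exact/asboolP.
move=> x y /asboolP Ix /asboolP Iy; apply/asboolP; exact: IB.
Qed.

HB.instance Definition _ S :=
  GRing.isZmodClosed.Build A (ideal_pred S) (ideal_pred_zmod_closed S).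

Definition ideal_zmodClosed S : zmodClosed A :=
  GRing.ZmodClosed.clone A (ideal_pred S) _.

End Ideals.

Record quiver := Quiver {
  vertex : finType;
  arrow : finType;
  src : arrow -> vertex;
  tgt : arrow -> vertex
}.

Section Paths.
Variable Q : quiver.

Fixpoint walk (v : vertex Q) (s : seq (arrow Q)) : bool :=
  if s is a :: s' then (src a == v) && walk (tgt a) s' else true.

(* A path is its starting vertex together with its arrows listed in the order *)
(* of traversal, i.e. right to left in the product notation.                  *)
Definition qpath : Type := {p : vertex Q * seq (arrow Q) | walk p.1 p.2}.
HB.instance Definition _ := SubChoice.on qpath.

Definition path_src (p : qpath) : vertex Q := (val p).1.
Definition path_arrows (p : qpath) : seq (arrow Q) := (val p).2.
Definition path_tgt (p : qpath) : vertex Q :=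
  last (path_src p) (map (@tgt Q) (path_arrows p)).

Definition trivial_path (v : vertex Q) : qpath :=
  exist (fun p => walk p.1 p.2) (v, [::]) isT.

Fact walk_arrow (a : arrow Q) : walk (src a) [:: a].
Proof. by rewrite /= eqxx. Qed.

Definition arrow_path (a : arrow Q) : qpath :=
  exist (fun p => walk p.1 p.2) (src a, [:: a]) (walk_arrow a).

(* [path_comp q p] is the path [q p], first [p] and then [q].                 *)
Definition path_comp (q p : qpath) : option qpath :=
  if path_tgt p == path_src q
  then (insub (path_src p, path_arrows p ++ path_arrows q) : option qpath)
  else None.

Lemma walk_cat v s1 s2 :
  walk v (s1 ++ s2) = walk v s1 && walk (last v (map (@tgt Q) s1)) s2.
Proof. by elim: s1 v => //= a s1 IH v; rewrite IH andbA. Qed.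

Variant path_comp_spec (q p : qpath) : option qpath -> Prop :=
| PathComp r of path_tgt p = path_src q & path_src r = path_src p
    & path_arrows r = path_arrows p ++ path_arrows q
    & path_tgt r = path_tgt q : path_comp_spec q p (Some r)
| PathNoComp of path_tgt p != path_src q : path_comp_spec q p None.

Lemma path_compP q p : path_comp_spec q p (path_comp q p).
Proof.
rewrite /path_comp; case: eqP => [pq|/eqP pq]; last by constructor.
case: insubP => [r _ rE|]; last first.
  by rewrite walk_cat (valP p) -/(path_tgt p) pq (valP q).
constructor=> //; rewrite /path_tgt /path_src /path_arrows rE //=.
by rewrite map_cat last_cat -/(path_src p) -/(path_tgt p) pq.
Qed.

Lemma path_eq p q :
  path_src p = path_src q -> path_arrows p = path_arrows q -> p = q.
Proof.
by case: p q => [[v s] p] [[w t] q] /= *; apply/val_inj; congr (_, _).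
Qed.

Lemma path_compA r q p :
  obind (path_comp r) (path_comp q p) = obind (path_comp^~ p) (path_comp r q).
Proof.
case: (path_compP q p) => [x pq xp xs xt|pq] /=;
  case: (path_compP r q) => [y qr yq ys yt|qr] //=.
- case: (path_compP r x) => [u _ us ua ut|]; last by rewrite xt qr eqxx.
  case: (path_compP y p) => [w _ ws wa wt|]; last by rewrite yq pq eqxx.
  by congr Some; apply: path_eq; rewrite ?us ?ws // ua wa xs ys catA.
- by case: (path_compP r x) => [u|//]; rewrite xt => /eqP; rewrite (negbTE qr).
- by case: (path_compP y p) => [u|//]; rewrite yq => /eqP; rewrite (negbTE pq).
Qed.

End Paths.

Section PathAlgebra.
Variables (k : fieldType) (Q : quiver).

(* Finitely supported functions from the paths to [k].                        *)
Definition path_algebra : Type := malg (qpath Q) k.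
HB.instance Definition _ := GRing.Lmodule.on path_algebra.

End PathAlgebra.

(* Locked, as is the product below: unification would otherwise unfold them   *)
(* and diverge.                                                               *)
HB.lock Definition path_elt (k : fieldType) (Q : quiver) (p : qpath Q) :
  path_algebra k Q := mkmalgU p 1.
Canonical path_elt_unlockable := Unlockable path_elt.unlock.

Section PathExt.
Variables (k : fieldType) (Q : quiver).
Local Notation path_algebra := (path_algebra k Q).
Local Notation path_elt := (@path_elt k Q).

Definition path_ext (V : lmodType k) (h : qpath Q -> V) (f : path_algebra) :
    V :=
  \sum_(p <- msupp f) mcoeff p f *: h p.

Lemma path_ext_elt (V : lmodType k) (h : qpath Q -> V) p :
  path_ext h (path_elt p) = h p.
Proof.
by rewrite unlock /path_ext msuppU oner_eq0 big_seq_fset1 mcoeffUU scale1r.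
Qed.

Lemma path_extw (V : lmodType k) (h : qpath Q -> V) (d : {fset qpath Q})
    (f : path_algebra) :
  {subset msupp f <= d} -> path_ext h f = \sum_(p <- d) mcoeff p f *: h p.
Proof.
move=> /fsubsetP fd; rewrite /path_ext (big_fset_incl _ fd) //.
by move=> p _ /mcoeff_outdom ->; rewrite scale0r.
Qed.

Lemma path_ext_linear (V : lmodType k) (h : qpath Q -> V) : linear (path_ext h).
Proof.
move=> c f g; pose d := (msupp f `|` msupp g)%fset.
have fd : {subset msupp f <= d} by apply/fsubsetP/fsubsetUl.
have gd : {subset msupp g <= d} by apply/fsubsetP/fsubsetUr.
have fgd : {subset msupp (c *: f + g) <= d}.
  apply/fsubsetP/(fsubset_trans (msuppD_le _ _)).
  by rewrite fsetSU // msuppZ_le.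
rewrite (path_extw h fd) (path_extw h gd) (path_extw h fgd).
rewrite scaler_sumr -big_split; apply: eq_bigr => p _ /=.
by rewrite mcoeffD mcoeffZ scalerDl scalerA.
Qed.

HB.instance Definition _ (V : lmodType k) (h : qpath Q -> V) :=
  GRing.isLinear.Build k path_algebra V *:%R (path_ext h)
    (@path_ext_linear V h).

Lemma mcoeff_path_elt p q : mcoeff q (path_elt p) = (p == q)%:R.
Proof. by rewrite unlock; exact: mcoeffU. Qed.

Lemma path_eltE (f : path_algebra) :
  f = \sum_(p <- msupp f) mcoeff p f *: path_elt p.
Proof.
rewrite {1}[f]monalgE; apply: eq_bigr => p _; apply/malgP => q.
apply: etrans (mcoeffU _ _ _) (esym (etrans (mcoeffZ _ _ _) _)).
by rewrite mcoeff_path_elt mulr_natr.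
Qed.

Lemma path_linear_eq (V : lmodType k) (f g : {linear path_algebra -> V}) :
  (forall p, f (path_elt p) = g (path_elt p)) -> f =1 g.
Proof.
move=> fg x; rewrite [x]path_eltE !linear_sum; apply: eq_bigr => p _.
by rewrite !linearZ fg.
Qed.

Definition path_elt_mul (q p : qpath Q) : path_algebra :=
  if path_comp q p is Some r then path_elt r else 0.

End PathExt.

HB.lock Definition path_mul (k : fieldType) (Q : quiver)
    (f g : path_algebra k Q) : path_algebra k Q :=
  path_ext (fun q => path_ext (path_elt_mul k q) g) f.
Canonical path_mul_unlockable := Unlockable path_mul.unlock.

Section PathRing.
Variables (k : fieldType) (Q : quiver).
Local Notation path_algebra := (path_algebra k Q).
Local Notation path_elt := (@path_elt k Q).
Local Notation path_mul := (@path_mul k Q).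

Definition path_one : path_algebra := \sum_v path_elt (trivial_path v).

Lemma path_mul_elt q p :
  path_mul (path_elt q) (path_elt p) = path_elt_mul k q p.
Proof. by rewrite unlock !path_ext_elt. Qed.

Lemma path_mul_linearl g : linear (path_mul^~ g).
Proof. by move=> c f f'; rewrite unlock linearP. Qed.

Lemma path_mul_linearr f : linear (path_mul f).
Proof.
move=> c g g'; rewrite unlock /path_ext scaler_sumr -big_split /=.
apply: eq_bigr => q _; rewrite -!/(path_ext _ _) linearP scalerDr.
by rewrite !scalerA mulrC.
Qed.

HB.instance Definition _ f :=
  GRing.isLinear.Build k path_algebra path_algebra *:%R (path_mul f)
    (path_mul_linearr f).

Definition path_mulr g f := path_mul f g.
HB.instance Definition _ g :=
  GRing.isLinear.Build k path_algebra path_algebra *:%R (path_mulr g)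
    (path_mul_linearl g).

Fact path_mulA : associative path_mul.
Proof.
move=> f g h.
have E1 := @path_linear_eq _ _ _ (path_mulr (path_mul g h))
  (path_mulr h \o path_mulr g).
apply: E1 => r /= {f}; rewrite /path_mulr.
have E2 := @path_linear_eq _ _ _ (path_mul (path_elt r) \o path_mulr h)
  (path_mulr h \o path_mul (path_elt r)).
apply: E2 => q /= {g}; rewrite /path_mulr.
have E3 := @path_linear_eq _ _ _
  (path_mul (path_elt r) \o path_mul (path_elt q))
  (path_mul (path_mul (path_elt r) (path_elt q))).
apply: E3 => p /= {h}; rewrite !path_mul_elt /path_elt_mul.
have := path_compA r q p.
case: (path_comp q p) (path_comp r q) => [x|] [y|] //=.
- by rewrite !path_mul_elt /path_elt_mul => ->.
- rewrite path_mul_elt /path_elt_mul => ->.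
  by rewrite -/(path_mulr _ _) linear0.
- by rewrite path_mul_elt /path_elt_mul => <-; rewrite linear0.
- by rewrite linear0 -/(path_mulr _ _) linear0.
Qed.

Fact path_mul1 : left_id path_one path_mul.
Proof.
move=> f; apply: (path_linear_eq (f := path_mul path_one) (g := idfun)) => p /=.
rewrite -/(path_mulr _ _) /path_one linear_sum (bigD1 (path_tgt p)) //=.
rewrite big1 ?addr0 => [|v vp]; rewrite /path_mulr path_mul_elt /path_elt_mul.
- case: path_compP => [r _ rs ra _|/eqP//]; congr path_elt.
  by apply: path_eq => //; rewrite ra cats0.
- by case: path_compP => // r pv; rewrite pv eqxx in vp.
Qed.

Fact path_mulr1 : right_id path_one path_mul.
Proof.
move=> f; apply: (path_linear_eq (f := path_mulr path_one) (g := idfun)) => p.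
rewrite /= /path_mulr /path_one linear_sum (bigD1 (path_src p)) //=.
rewrite big1 ?addr0 => [|v vp]; rewrite path_mul_elt /path_elt_mul.
- case: path_compP => [r _ rs ra _|/eqP//]; congr path_elt.
  exact: path_eq.
- by case: path_compP => // r pv; rewrite -pv eqxx in vp.
Qed.

Fact path_mulDl : left_distributive path_mul +%R.
Proof. by move=> f g h; rewrite -[LHS]/(path_mulr h _) linearD. Qed.

Fact path_mulDr : right_distributive path_mul +%R.
Proof. by move=> f g h; rewrite linearD. Qed.

HB.instance Definition _ := GRing.Zmodule_isPzRing.Build path_algebra
  path_mulA path_mul1 path_mulr1 path_mulDl path_mulDr.

(* Not packaged as an [algType], which would require [1 != 0]; this fails for *)
(* the quiver without vertices.                                               *)
Fact path_scaleAl (c : k) (f g : path_algebra) : c *: (f * g) = (c *: f) * g.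
Proof. by rewrite -[RHS]/(path_mulr g _) linearZ. Qed.

Fact path_scaleAr (c : k) (f g : path_algebra) : c *: (f * g) = f * (c *: g).
Proof. by rewrite -[RHS]/(path_mul f _) linearZ. Qed.

End PathRing.

Section QuotientAlgebra.
Variables (k : fieldType) (Q : quiver).
Local Notation A := (path_algebra k Q).
Variable S : set A.

(* The ring quotients of MathComp are commutative, so only its quotient by an *)
(* additive subgroup is reused here.                                          *)
Definition quotient_algebra : Type := Quotient.quot (ideal_zmodClosed S).
HB.instance Definition _ := GRing.Zmodule.on quotient_algebra.

Local Notation B := quotient_algebra.

Definition quotient_pi (x : A) : B :=
  \pi_(Quotient.quot (ideal_zmodClosed S)) x.
Definition quotient_repr (u : B) : A := repr u.

Lemma quotient_reprK : cancel quotient_repr quotient_pi.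
Proof. by move=> u; exact: reprK. Qed.

Lemma quotient_piP x y : quotient_pi x = quotient_pi y <-> ideal_gen S (x - y).
Proof.
split=> [/eqP|xy].
  by rewrite -Quotient.idealrBE => /asboolP.
by apply/eqP; rewrite -Quotient.idealrBE; apply/asboolP.
Qed.

Lemma quotient_piB : zmod_morphism quotient_pi.
Proof. by move=> x y; rewrite /quotient_pi raddfB. Qed.

HB.instance Definition _ :=
  GRing.isZmodMorphism.Build A B quotient_pi quotient_piB.

Definition quotient_mul (u v : B) : B :=
  quotient_pi (quotient_repr u * quotient_repr v).
Definition quotient_scale (c : k) (u : B) : B :=
  quotient_pi (c *: quotient_repr u).

Lemma quotient_piM x y :
  quotient_pi (x * y) = quotient_mul (quotient_pi x) (quotient_pi y).
Proof.
have [I0 IB IMl IMr] := ideal_gen_ideal S.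
have xr z : ideal_gen S (z - quotient_repr (quotient_pi z)).
  by apply/quotient_piP; rewrite quotient_reprK.
set y' := quotient_repr (quotient_pi y).
apply: (etrans (y := quotient_pi (x * y'))); apply/quotient_piP.
  by rewrite -mulrBr; apply: IMl; exact: xr.
by rewrite -mulrBl; apply: IMr; exact: xr.
Qed.

Lemma quotient_piZ c x :
  quotient_pi (c *: x) = quotient_scale c (quotient_pi x).
Proof.
have [_ _ IMl _] := ideal_gen_ideal S.
apply/quotient_piP; rewrite -scalerBr -[_ - _]mul1r path_scaleAl.
by apply: IMl; apply/quotient_piP; rewrite quotient_reprK.
Qed.

Fact quotient_mulA : associative quotient_mul.
Proof.
move=> u v w; rewrite -[u]quotient_reprK -[v]quotient_reprK.
by rewrite -[w]quotient_reprK -!quotient_piM mulrA.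
Qed.

Fact quotient_mul1 : left_id (quotient_pi 1) quotient_mul.
Proof. by move=> u; rewrite -[u]quotient_reprK -quotient_piM mul1r. Qed.

Fact quotient_mulr1 : right_id (quotient_pi 1) quotient_mul.
Proof. by move=> u; rewrite -[u]quotient_reprK -quotient_piM mulr1. Qed.

Fact quotient_mulDl : left_distributive quotient_mul +%R.
Proof.
move=> u v w; rewrite -[u]quotient_reprK -[v]quotient_reprK.
by rewrite -[w]quotient_reprK -raddfD -!quotient_piM -raddfD mulrDl.
Qed.

Fact quotient_mulDr : right_distributive quotient_mul +%R.
Proof.
move=> u v w; rewrite -[u]quotient_reprK -[v]quotient_reprK.
by rewrite -[w]quotient_reprK -raddfD -!quotient_piM -raddfD mulrDr.
Qed.

HB.instance Definition _ := GRing.Zmodule_isPzRing.Build B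
  quotient_mulA quotient_mul1 quotient_mulr1 quotient_mulDl quotient_mulDr.

Fact quotient_scaleA a b u :
  quotient_scale a (quotient_scale b u) = quotient_scale (a * b) u.
Proof. by rewrite -[u]quotient_reprK -!quotient_piZ scalerA. Qed.

Fact quotient_scale1 : left_id 1 quotient_scale.
Proof. by move=> u; rewrite -[u]quotient_reprK -quotient_piZ scale1r. Qed.

Fact quotient_scaleDr : right_distributive quotient_scale +%R.
Proof.
move=> c u v; rewrite -[u]quotient_reprK -[v]quotient_reprK.
by rewrite -raddfD -!quotient_piZ -raddfD scalerDr.
Qed.

Fact quotient_scaleDl u : {morph quotient_scale^~ u : a b / a + b}.
Proof.
by move=> a b; rewrite -[u]quotient_reprK -!quotient_piZ -raddfD scalerDl.
Qed.

HB.instance Definition _ := GRing.Zmodule_isLmodule.Build k B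
  quotient_scaleA quotient_scale1 quotient_scaleDr quotient_scaleDl.

Fact quotient_scaleAl (c : k) (u v : B) : c *: (u * v) = (c *: u) * v.
Proof.
rewrite -[u]quotient_reprK -[v]quotient_reprK.
change (quotient_scale c
    (quotient_mul (quotient_pi (quotient_repr u))
      (quotient_pi (quotient_repr v)))
  = quotient_mul (quotient_scale c (quotient_pi (quotient_repr u)))
      (quotient_pi (quotient_repr v))).
by rewrite -!(quotient_piM, quotient_piZ) path_scaleAl.
Qed.

Fact quotient_scaleAr (c : k) (u v : B) : c *: (u * v) = u * (c *: v).
Proof.
rewrite -[u]quotient_reprK -[v]quotient_reprK.
change (quotient_scale c
    (quotient_mul (quotient_pi (quotient_repr u))
      (quotient_pi (quotient_repr v)))
  = quotient_mul (quotient_pi (quotient_repr u))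
      (quotient_scale c (quotient_pi (quotient_repr v)))).
by rewrite -!(quotient_piM, quotient_piZ) path_scaleAr.
Qed.

End QuotientAlgebra.

Definition C1 (R : realType) (f : R -> R) : Prop :=
  (forall t, derivable f t 1) /\ continuous (derive1 f).

(* Coordinates of a regular C^1 embedding of the circle R/Z into 3-space; the *)
(* orientation is that of increasing parameter.                               *)
Record oriented_knot (R : realType) := OrientedKnot {
  kx : R -> R;
  ky : R -> R;
  kz : R -> R;
  knot_C1 : [/\ C1 kx, C1 ky & C1 kz];
  knot_periodic :
    forall t, [/\ kx (t + 1) = kx t, ky (t + 1) = ky t & kz (t + 1) = kz t];
  knot_regular :
    forall t, (derive1 kx t, derive1 ky t, derive1 kz t) <> (0, 0, 0);
  knot_inj : {in `[0, 1[ &, injective (fun t => (kx t, ky t, kz t))}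
}.

Section Projection.
Variables (R : realType) (K : oriented_knot R).

Definition shadow (t : R) : R * R := (kx K t, ky K t).
Definition velocity (t : R) : R * R := (derive1 (kx K) t, derive1 (ky K) t).

Definition double_point (s t : R) : Prop :=
  [/\ s \in `[0, 1[, t \in `[0, 1[, s <> t & shadow s = shadow t].

Definition regular_projection : Prop :=
  [/\ forall t, velocity t <> (0, 0),
      forall s t u, double_point s t -> double_point t u -> s = u
    & forall s t, double_point s t ->
        (velocity s).1 * (velocity t).2 - (velocity s).2 * (velocity t).1 <> 0].

End Projection.

(* The diagram is the projection along the z-axis; larger z is over.  The     *)
(* list [passages] of the parameters at which the curve goes through a        *)
(* crossing witnesses that there are finitely many of them; it is determined  *)
(* by the knot.                                                               *)
Record knot_diagram (R : realType) := KnotDiagram {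
  knot :> oriented_knot R;
  knot_projection : regular_projection knot;
  passages : seq R;
  passages_sorted : sorted <%R passages;
  passagesP : forall t, t \in passages <-> exists s, double_point knot s t
}.

Section DiagramQuiver.
Variables (R : realType) (D : knot_diagram R).

Local Notation passage_index := 'I_(size (passages D)).

Definition passage (i : passage_index) : R := tnth (in_tuple (passages D)) i.

Definition crossing : finType := seq_sub [seq shadow D t | t <- passages D].

Fact shadow_passage_mem i :
  shadow D (passage i) \in [seq shadow D t | t <- passages D].
Proof. exact/map_f/mem_tnth. Qed.

Definition crossing_of (i : passage_index) : crossing :=
  SeqSub (shadow_passage_mem i).

Definition over (i : passage_index) : bool :=
  [exists j, (crossing_of j == crossing_of i) &&
             (kz D (passage j) < kz D (passage i))].

(* Arrow [i] is the segment from passage [i] to the cyclically next one.      *)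
Definition diagram_quiver : quiver :=
  @Quiver crossing passage_index crossing_of (fun i => crossing_of (ordS i)).

Local Notation Q := diagram_quiver.

Definition next_arrow (a : arrow Q) : arrow Q := ordS a.
Definition source_positive (a : arrow Q) : bool := over a.
Definition target_positive (a : arrow Q) : bool := over (ordS a).

Fact browse_walk (a : arrow Q) (n : nat) :
  walk (src a) (traject next_arrow a n).
Proof. by elim: n a => //= n IH a; rewrite eqxx IH. Qed.

(* Browse the diagram from [a] up to and including the first arrow satisfying *)
(* [stop].                                                                    *)
Definition browse (a : arrow Q) (stop : pred (arrow Q)) : qpath Q :=
  let n := (find stop (traject next_arrow a #|arrow Q|)).+1 in
  exist (fun p => walk p.1 p.2) (src a, traject next_arrow a n)
    (browse_walk a n).

Lemma crossing_ofE i j :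
  (crossing_of i == crossing_of j)
    = (shadow D (passage i) == shadow D (passage j)).
Proof. by rewrite -val_eqE. Qed.

Lemma passage_ex s t : double_point D s t -> exists i, passage i = t.
Proof.
move=> st; have /(tnthP (in_tuple _)) [i ti] : t \in passages D.
  by apply/passagesP; exists s.
by exists i; rewrite /passage -ti.
Qed.

Lemma double_pointC s t : double_point D s t -> double_point D t s.
Proof. by case=> Is It st E; split=> // ts; apply: st. Qed.

Lemma double_point_over s i :
  double_point D s (passage i) -> kz D s < kz D (passage i) -> over i.
Proof.
move=> st lt_st; have [j jE] := passage_ex (double_pointC st).
apply/existsP; exists j; rewrite crossing_ofE jE lt_st andbT.
by apply/eqP; case: st.
Qed.

Lemma double_point_under s i :
  double_point D s (passage i) -> kz D (passage i) < kz D s -> ~~ over i.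
Proof.
move=> st lt_ts; apply/existsPn => j; apply/negP => /andP[].
rewrite crossing_ofE => /eqP ji lt_ji.
have [_ no_triple _] := knot_projection D.
have /passagesP [u [_ Ij _ _]] : passage j \in passages D by exact: mem_tnth.
have [_ Ii _ _] := st.
have jti : double_point D (passage j) (passage i).
  by split=> // jiE; rewrite jiE ltxx in lt_ji.
have sj := no_triple _ _ _ st (double_pointC jti).
by rewrite -sj in lt_ji; have := lt_trans lt_ji lt_ts; rewrite ltxx.
Qed.

Lemma crossing_over_under (e : crossing) :
  exists i j, [/\ crossing_of i = e, crossing_of j = e, over i & ~~ over j].
Proof.
have /mapP [t /passagesP [s st] et] := valP e.
have [i iE] := passage_ex st; have [j jE] := passage_ex (double_pointC st).
have [Is It neq_st sh] := st.
have ie : crossing_of i = e by apply/val_inj; rewrite /= iE.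
have je : crossing_of j = e by apply/val_inj; rewrite /= jE sh.
have ts := double_pointC st; rewrite -iE -jE in st ts.
case: (ltgtP (kz D (passage j)) (kz D (passage i))) => z.
- by exists i, j; split=> //; [exact: double_point_over st z
                              |exact: double_point_under ts z].
- by exists j, i; split=> //; [exact: double_point_over ts z
                              |exact: double_point_under st z].
- case: neq_st; apply: (knot_inj Is It).
  have zE : kz D s = kz D t by rewrite -iE -jE.
  by case: sh => Ex Ey; exact: f_equal2 (f_equal2 pair Ex Ey) zE.
Qed.

Fact ex_positive_source (e : vertex Q) :
  exists a : arrow Q, (src a == e) && source_positive a.
Proof.
by have [i [_ [ie _ oi _]]] := crossing_over_under e;
  exists i; apply/andP/(conj _ oi)/eqP.
Qed.

Fact ex_negative_source (e : vertex Q) :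
  exists a : arrow Q, (src a == e) && ~~ source_positive a.
Proof.
by have [_ [j [_ je _ oj]]] := crossing_over_under e;
  exists j; apply/andP/(conj _ oj)/eqP.
Qed.

Definition alpha (e : vertex Q) : qpath Q :=
  browse (xchoose (ex_positive_source e))
    [pred b | (tgt b == e) && ~~ target_positive b].

Definition beta (e : vertex Q) : qpath Q :=
  browse (xchoose (ex_negative_source e))
    [pred b | (tgt b == e) && target_positive b].

End DiagramQuiver.

Section DiagramAlgebra.
Variables (k : fieldType) (R : realType) (D : knot_diagram R).
Local Notation Q := (diagram_quiver D).
Variable tau : vertex Q -> k.
Local Notation kQ := (path_algebra k Q).

Definition type_I : set kQ :=
  [set x | exists a b : arrow Q,
     [/\ tgt a = src b, target_positive a != source_positive b
       & x = path_elt k (arrow_path b) * path_elt k (arrow_path a)]].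

Definition type_II : set kQ :=
  [set x | exists e : vertex Q,
     let al := path_elt k (alpha e) in let be := path_elt k (beta e) in
     x = al * be - tau e *: (be * al)].

Definition diagram_algebra : Type :=
  quotient_algebra (type_I `|` type_II).
HB.instance Definition _ := GRing.PzRing.on diagram_algebra.
HB.instance Definition _ := GRing.Lmodule.on diagram_algebra.

End DiagramAlgebra.

(* Main.v *)
(* A path that follows the knot without turning is a strand; the type I       *)
(* relations kill every other path, so the algebra is spanned by strands.     *)
(* With N passages in all, alpha_e beta_e and beta_e alpha_e are the two full *)
(* circles (strands of length N) at e, and type II makes them proportional.   *)
(* Hence a strand of length greater than N vanishes: replacing the circle in  *)
(* it by the other circle at the same crossing creates a turn.  The linear    *)
(* functional supported on full circles, with value 1 on beta_e alpha_e and   *)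
(* tau e on alpha_e beta_e, vanishes on the ideal; the form is (x, y) |->     *)
(* functional (x y).  In the basis of strands its Gram matrix is monomial: a  *)
(* strand pairs nontrivially only with its complement in the full circle.     *)

Require Import Defs.
From HB Require Import structures.
From mathcomp Require Import all_boot all_order all_algebra sesquilinear.
From mathcomp Require Import reals.
From mathcomp Require Import classical_sets.
From mathcomp Require monalg.

Set Implicit Arguments.
Unset Strict Implicit.
Unset Printing Implicit Defensive.

Import Order.TTheory GRing.Theory.
Local Open Scope ring_scope.

(** A passage is identified with the arrow leaving it, so browsing the diagram is the cyclic
    successor on N passages. Each crossing has one over- and one under-passage
    ([source_positive_inj], [crossing_mate]). Hence [alpha] and [beta] at a crossing are
    complementary arcs of the knot ([alpha_beta_strand]), and two composable arrows are either
    consecutive or a type I relation ([pi_turn0]). So the strands selected by [basis_index] span the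
    algebra ([basis_span]). The circle functional descends to the quotient by
    [relations_circle_functional0], and [diagram_form_basis] computes the Gram matrix. Linear
    independence is not proved beforehand: pairing a combination of strands with the complement of
    one of them isolates a single coefficient, so spanning alone gives nondegeneracy on both
    sides. *)

(** * Iterates of the cyclic successor *)

Lemma val_iter_ordS N (i : 'I_N) m :
  iter m (@ordS N) i = ((i + m) %% N)%N :> nat.
Proof.
elim: m => [|m IH] /=; first by rewrite addn0 modn_small.
by rewrite IH addnS -addn1 modnDml addn1.
Qed.

Lemma iter_ordS_size N (i : 'I_N) : iter N (@ordS N) i = i.
Proof. by apply/val_inj; rewrite /= val_iter_ordS modnDr modn_small. Qed.

Lemma mem_traject_ordS N (i j : 'I_N) : j \in traject (@ordS N) i N.
Proof.
have N_gt0 : (0 < N)%N by apply: leq_ltn_trans (ltn_ord i).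
apply/trajectP; exists ((j + (N - i)) %% N)%N; first by rewrite ltn_mod.
apply/val_inj; rewrite /= val_iter_ordS modnDmr addnCA subnKC 1?ltnW //.
by rewrite modnDr modn_small.
Qed.

Lemma iter_ordS_fix N (i : 'I_N) m : iter m (@ordS N) i = i -> (N %| m)%N.
Proof.
move/(congr1 val); rewrite /= val_iter_ordS => im.
have := eqn_modDl i m 0 N.
by rewrite im addn0 modn_small // eqxx mod0n => /esym.
Qed.

Lemma fsorted_traject (T : eqType) (f : T -> T) x n :
  sorted (frel f) (traject f x n).
Proof. by case: n => //= n; apply: fpath_traject. Qed.

(** Both pieces are nonempty, so there is a junction to test; with an empty piece the concatenation
    would always be sorted. *)
Lemma fsorted_cat_traject (T : eqType) (f : T -> T) x y m n :
  sorted (frel f) (traject f x m.+1 ++ traject f y n.+1) = (iter m.+1 f x == y).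
Proof.
by rewrite /= cat_path fpath_traject last_traject /= fpath_traject andbT.
Qed.

(** * Signs at crossings, strands, and the two cycles at a vertex *)

Section Diagram.
Variables (R : realType) (D : knot_diagram R).
Local Notation Q := (diagram_quiver D).
Local Notation N := (size (passages D)).
Local Notation next := (@next_arrow R D).
Implicit Types (i j o u : arrow Q) (e : vertex Q).

Lemma passage_inj : injective (@passage R D).
Proof.
move=> i j ij; apply/val_inj/eqP.
have uniqD : uniq (passages D) := lt_sorted_uniq (passages_sorted D).
rewrite -(nth_uniq 0 (ltn_ord i) (ltn_ord j) uniqD).
by apply/eqP; move: ij; rewrite /passage !(tnth_nth 0).
Qed.

(** Two distinct passages at one crossing have different heights, because the knot is embedded; the
    higher one is over and the lower one is not. *)
Lemma source_positive_inj i j :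
  src i = src j -> source_positive i = source_positive j -> i = j.
Proof.
move=> /eqP; rewrite /= crossing_ofE => /eqP shij oij.
apply/eqP/negP => /negP neq_ij.
have unit_passage (l : arrow Q) : passage l \in `[0, 1[.
  by have /passagesP [s []] : passage l \in passages D by apply: mem_tnth.
have dij : double_point D (passage i) (passage j).
  by split=> // /passage_inj /eqP; apply/negP.
case: (ltgtP (kz D (passage i)) (kz D (passage j))) => z.
- have := double_point_over dij z.
  have := double_point_under (double_pointC dij) z.
  by rewrite -/(source_positive i) oij => /negP.
- have := double_point_under dij z.
  have := double_point_over (double_pointC dij) z.
  by rewrite -/(source_positive i) oij => ? /negP.
- have [_ _ neq_p _] := dij; apply: neq_p; apply: (knot_inj (o := D)) => //=.
  by case: shij => -> ->; rewrite z.
Qed.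

Lemma tgt_src i : tgt i = src (next i). Proof. by []. Qed.

Definition strand i l : qpath Q :=
  exist (fun p => walk p.1 p.2) (src i, traject next i l) (browse_walk i l).

Lemma strand_arrows i l : path_arrows (strand i l) = traject next i l.
Proof. by []. Qed.

Lemma strand_src i l : path_src (strand i l) = src i.
Proof. by []. Qed.

Lemma strand_tgt i l : path_tgt (strand i l) = src (iter l next i).
Proof.
rewrite /path_tgt strand_src strand_arrows; case: l => // l.
by rewrite /= (last_map _ _ i) last_traject.
Qed.

Lemma passages_gt0 i : (0 < N)%N.
Proof. exact: leq_ltn_trans (leq0n i) (ltn_ord i). Qed.

Lemma iter_next_size i : iter N next i = i.
Proof. exact: iter_ordS_size. Qed.

(** N consecutive arrows exhaust the diagram, so the search meets the predecessor of [j]; the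
    stopping arrow is included, which makes the length positive. *)
Lemma browse_next i j (stop : pred (arrow Q)) :
  (forall a, stop a = (next a == j)) ->
  exists n, [/\ browse i stop = strand i n, iter n next i = j & (0 < n <= N)%N].
Proof.
move=> stopE; set s := traject next i N.
have has_stop : has stop s.
  apply/hasP; exists (ord_pred j); first exact: mem_traject_ordS.
  by rewrite stopE; apply/eqP; exact: ord_predK.
have find_lt := has_stop; rewrite has_find size_traject in find_lt.
exists (find stop s).+1; split=> //; first by rewrite /browse card_ord.
have := nth_find i has_stop; rewrite stopE nth_traject // => /eqP <-.
by rewrite -iterS.
Qed.

Section Crossing.
Variables (o u : arrow Q).
Hypotheses (ou : src o = src u) (po : source_positive o)
  (pu : ~~ source_positive u).

Lemma alpha_strand : exists n,
  [/\ alpha (src o) = strand o n, iter n next o = u & (0 < n <= N)%N].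
Proof.
rewrite /alpha; have -> : xchoose (ex_positive_source (src o)) = o.
  have /andP[/eqP xe px] := xchooseP (ex_positive_source (src o)).
  by apply: source_positive_inj; rewrite // px po.
apply: browse_next => a; apply/andP/eqP => [[/eqP ae pa]|au].
  apply: source_positive_inj; first by rewrite -tgt_src ae.
  by rewrite (negbTE pu); apply: negbTE.
by rewrite /target_positive tgt_src -/(next a) au ou eqxx.
Qed.

Lemma beta_strand : exists n,
  [/\ beta (src o) = strand u n, iter n next u = o & (0 < n <= N)%N].
Proof.
rewrite /beta; have -> : xchoose (ex_negative_source (src o)) = u.
  have /andP[/eqP xe px] := xchooseP (ex_negative_source (src o)).
  by apply: source_positive_inj; rewrite ?xe // (negbTE px) (negbTE pu).
apply: browse_next => a; apply/andP/eqP => [[/eqP ae pa]|ao].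
  apply: source_positive_inj; first by rewrite -tgt_src ae.
  by rewrite po; apply: pa.
by rewrite /target_positive tgt_src -/(next a) ao eqxx.
Qed.

Lemma alpha_beta_strand : exists m n,
  [/\ alpha (src o) = strand o m, beta (src o) = strand u n,
      iter m next o = u, iter n next u = o & (m + n)%N = N].
Proof.
have [m [-> om /andP[m_gt0 mN]]] := alpha_strand.
have [n [-> un /andP[n_gt0 nN]]] := beta_strand.
exists m, n; split=> //.
have neq_ou : o != u by apply: contraNneq pu => <-.
have ltmN : (m < N)%N.
  rewrite ltn_neqAle mN andbT; apply: contraNneq neq_ou => mE.
  by rewrite -om mE iter_next_size.
(* Following both arcs returns to [o], so m + n is a multiple of N; it is positive and, as m < N and
   n <= N, less than 2N. *)
have /iter_ordS_fix /dvdnP [[|[|q]] qE] : iter (m + n) next o = o.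
- by rewrite addnC iterD om.
- by move: qE m_gt0 => /eqP; rewrite mul0n addn_eq0 => /andP[/eqP->].
- by rewrite qE mul1n.
- have : (m + n < N + N)%N by rewrite -addSn leq_add.
  by rewrite qE mulSn mulSn addnA -{2}[(N + N)%N]addn0 ltn_add2l.
Qed.

End Crossing.

Lemma over_under_arrows e : exists o u,
  [/\ src o = e, src u = e, source_positive o & ~~ source_positive u].
Proof. by have [o [u [oe ue po pu]]] := crossing_over_under e; exists o, u. Qed.

Lemma crossing_mate i : exists j,
  src j = src i /\ source_positive j = ~~ source_positive i.
Proof.
have [o [u [oi ui po pu]]] := over_under_arrows (src i).
by case: source_positive; [exists u; rewrite (negbTE pu) | exists o].
Qed.

End Diagram.

(** * Products of paths in the path algebra *)

Section PathElements.
Variables (k : fieldType) (Q : quiver).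
Implicit Types (p q r : qpath Q) (x y : path_algebra k Q).

Definition walk_path (v : vertex Q) (s : seq (arrow Q)) (w : walk v s) :
    qpath Q :=
  exist (fun vs => walk vs.1 vs.2) (v, s) w.

Variant path_elt_mul_spec p q : path_algebra k Q -> Prop :=
| PathEltMul r of path_tgt q = path_src p & path_src r = path_src q
    & path_arrows r = path_arrows q ++ path_arrows p
    & path_tgt r = path_tgt p : path_elt_mul_spec p q (path_elt k r)
| PathEltMul0 of path_tgt q != path_src p : path_elt_mul_spec p q 0.

Lemma path_elt_mulP p q :
  path_elt_mul_spec p q (path_elt k p * path_elt k q).
Proof.
have -> : path_elt k p * path_elt k q = path_elt_mul k p q.
  exact: path_mul_elt.
by rewrite /path_elt_mul; case: path_compP => *; constructor.
Qed.

Lemma path_elt_mul_cat p q r :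
    path_tgt q = path_src p -> path_src r = path_src q ->
    path_arrows r = path_arrows q ++ path_arrows p ->
  path_elt k p * path_elt k q = path_elt k r.
Proof.
move=> qp rq ra.
case: path_elt_mulP => [r' _ r'q r'a _|]; last by rewrite qp eqxx.
by congr path_elt; apply: path_eq; rewrite ?r'q ?r'a.
Qed.

Lemma walk_path_cons v a s (w : walk v (a :: s)) :
  exists w' : walk (tgt a) s,
    path_elt k (walk_path w)
      = path_elt k (walk_path w') * path_elt k (arrow_path a).
Proof.
have /= /andP[/eqP av w'] := w; exists w'.
by apply/esym/path_elt_mul_cat => //; rewrite /path_src /= av.
Qed.

Lemma path_functional_sandwich0 (lam : {linear path_algebra k Q -> k^o}) x :
    (forall p q, lam (path_elt k p * x * path_elt k q) = 0) ->
  forall a b, lam (a * x * b) = 0.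
Proof.
move=> lam0 a b; rewrite [a]path_eltE [b]path_eltE !mulr_suml linear_sum.
rewrite big1 // => p _.
rewrite mulr_sumr linear_sum big1 // => q _.
by rewrite -!path_scaleAl -path_scaleAr !linearZ /= lam0 !scaler0.
Qed.

End PathElements.

(** * The associative form induced by a functional that kills the ideal *)

Section QuotientFunctional.
Variables (k : fieldType) (Q : quiver) (S : set (path_algebra k Q)).
Variable lam : {linear path_algebra k Q -> k^o}.
Hypothesis lamS : forall s, S s -> forall a b, lam (a * s * b) = 0.

(** The elements x with lam (a x b) = 0 for all a and b form a two-sided ideal containing S, and a =
    b = 1 puts it inside the kernel of [lam]. *)
Lemma functional_ideal0 x : ideal_gen S x -> lam x = 0.
Proof.
move=> Sx.
have J_ideal : two_sided_ideal [set x | forall a b, lam (a * x * b) = 0].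
  split=> [a b|y z y0 z0 a b|c y y0 a b|c y y0 a b] /=.
  - by rewrite mulr0 mul0r linear0.
  - by rewrite mulrBr mulrBl linearB y0 z0 subrr.
  - by rewrite mulrA y0.
  - by rewrite mulrA -mulrA y0.
by have := Sx _ (conj J_ideal lamS) 1 1; rewrite mul1r mulr1.
Qed.

Definition quotient_functional (u : quotient_algebra S) : k :=
  lam (quotient_repr u).

Lemma quotient_functional_pi x : quotient_functional (quotient_pi S x) = lam x.
Proof.
apply/eqP; rewrite -subr_eq0 -[_ - _](linearB lam); apply/eqP/functional_ideal0.
by apply/quotient_piP; rewrite quotient_reprK.
Qed.

Lemma quotient_functional_linear : linear_for *%R quotient_functional.
Proof.
move=> c u v; rewrite -[u]quotient_reprK -[v]quotient_reprK.
rewrite -[X in X + _]quotient_piZ -raddfD !quotient_functional_pi.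
exact: linearP.
Qed.

Definition functional_form (u v : quotient_algebra S) : k :=
  quotient_functional (u * v).

Lemma functional_form_bilinear : bilinear_for *%R *%R functional_form.
Proof.
split=> w c u v; rewrite /functional_form.
  by rewrite mulrDl -quotient_scaleAl quotient_functional_linear.
by rewrite mulrDr -quotient_scaleAr quotient_functional_linear.
Qed.

End QuotientFunctional.

(** * The circle functional vanishes on the ideal *)

Section DiagramForm.
Variables (k : fieldType) (R : realType) (D : knot_diagram R).
Local Notation Q := (diagram_quiver D).
Variable tau : vertex Q -> k.
Hypothesis tau_neq0 : forall e, tau e != 0.
Local Notation kQ := (path_algebra k Q).
Local Notation N := (size (passages D)).
Local Notation next := (@next_arrow R D).
Local Notation elt := (@path_elt k Q).
Local Notation Lambda := (diagram_algebra tau).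
Local Notation relations := (type_I (k := k) (D := D) `|` type_II tau)%classic.
Implicit Types (i j o u : arrow Q) (p q r : qpath Q).

Definition browsing (s : seq (arrow Q)) := sorted (frel next) s.

(* The two values make [alpha_e beta_e] and [tau e *: beta_e alpha_e] have *)
(* the same image under [circle_functional]. *)
Definition start_weight i : k := if source_positive i then 1 else tau (src i).

Definition circle_weight (s : seq (arrow Q)) : k :=
  if browsing s && (size s == N) then
    if s is i :: _ then start_weight i else 0
  else 0.

Definition circle_functional : kQ -> k^o :=
  path_ext (fun p => circle_weight (path_arrows p) : k^o).

HB.instance Definition _ := GRing.Linear.on circle_functional.

Lemma start_weight_neq0 i : start_weight i != 0.
Proof. by rewrite /start_weight; case: ifP => _; rewrite ?oner_neq0. Qed.

Lemma circle_functional_elt p :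
  circle_functional (elt p) = circle_weight (path_arrows p).
Proof. exact: path_ext_elt. Qed.

Lemma circle_functional_elt2 p q :
  circle_functional (elt p * elt q) =
    if path_tgt q == path_src p
    then circle_weight (path_arrows q ++ path_arrows p) else 0.
Proof.
case: path_elt_mulP => [r qp _ ra _|/negbTE->]; last exact: linear0.
by rewrite circle_functional_elt ra qp eqxx.
Qed.

Lemma circle_functional_elt3 p r q :
  circle_functional (elt p * elt r * elt q) =
    if (path_tgt q == path_src r) && (path_tgt r == path_src p)
    then circle_weight (path_arrows q ++ path_arrows r ++ path_arrows p) else 0.
Proof.
case: path_elt_mulP => [x rp xr xa _|/negbTE->]; last first.
  by rewrite andbF mul0r linear0.
by rewrite circle_functional_elt2 xr xa rp eqxx andbT.
Qed.

Lemma circle_weight_circle i :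
  circle_weight (traject next i N) = start_weight i.
Proof.
rewrite /circle_weight size_traject eqxx /browsing fsorted_traject /=.
have -> : traject next i N = i :: traject next (next i) N.-1; last by [].
by rewrite -trajectS prednK ?(passages_gt0 i).
Qed.

Lemma browsing_cat s1 s2 : browsing (s1 ++ s2) -> browsing s1 /\ browsing s2.
Proof. by case/cat_sorted2. Qed.

Lemma strand_mul i l m :
  elt (strand (iter l next i) m) * elt (strand i l) = elt (strand i (l + m)).
Proof.
apply: path_elt_mul_cat; rewrite ?strand_tgt ?strand_src ?strand_arrows //.
exact: trajectD.
Qed.

Section Crossing.
Variables (o u : arrow Q).
Hypotheses (ou : src o = src u) (po : source_positive o)
  (pu : ~~ source_positive u).

(** Since products read right to left, the product of [alpha] and [beta] runs through [beta] first
    and is the circle from the under-passage [u]. *)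
Lemma type_II_strandE :
  elt (alpha (src o)) * elt (beta (src o))
    - tau (src o) *: (elt (beta (src o)) * elt (alpha (src o)))
  = elt (strand u N) - tau (src o) *: elt (strand o N).
Proof.
have [m [n [-> -> om un mn]]] := alpha_beta_strand ou po pu.
by rewrite -{1}un -{3}om !strand_mul -mn [(n + m)%N]addnC.
Qed.

End Crossing.

(** A type I factor puts a turn inside the path. A type II factor padded by arrows is longer than N;
    without padding, the two start weights cancel. *)
Lemma relations_circle_functional0 s : relations s ->
  forall a b, circle_functional (a * s * b) = 0.
Proof.
move=> Ss; apply: path_functional_sandwich0 => p q /=.
case: Ss => [[a [b [ab signs ->]]]|[e /= ->]].
  case: path_elt_mulP => [r _ _ ra _|/eqP[]]; last exact: ab.
  rewrite circle_functional_elt3; case: ifP => // _.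
  rewrite /circle_weight; case: ifP => // /andP[+ _].
  move=> /browsing_cat[_ /browsing_cat[+ _]]; rewrite ra /browsing /= andbT.
  by move=> /eqP nab; rewrite -nab eqxx in signs.
have [o [u [oe ue po pu]]] := over_under_arrows e.
have ou : src o = src u by rewrite oe ue.
rewrite -{}oe {e ue} in ou *; rewrite (type_II_strandE ou po pu).
rewrite mulrBr mulrBl linearB /= -path_scaleAr -path_scaleAl linearZ /=.
rewrite !circle_functional_elt3 !strand_tgt !strand_src.
rewrite !strand_arrows !iter_next_size.
rewrite -ou; case: ifP => _; last by rewrite scaler0 subrr.
have [/eqP|pq_gt0] := posnP (size (path_arrows q) + size (path_arrows p)).
  rewrite addn_eq0 !size_eq0 => /andP[/eqP-> /eqP->]; rewrite !cats0 /=.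
  rewrite !circle_weight_circle /start_weight po (negbTE pu) -ou.
  by rewrite /GRing.scale /= mulr1 subrr.
have too_long i : circle_weight
    (path_arrows q ++ traject next i N ++ path_arrows p) = 0.
  rewrite /circle_weight !size_cat size_traject addnCA -[X in _ == X]addn0.
  rewrite eqn_add2l.
  by rewrite eqn0Ngt pq_gt0 andbF.
by rewrite !too_long scaler0 subrr.
Qed.

(** * Strands span the quotient *)

Local Notation pi := (quotient_pi relations).

Lemma piM x y : pi (x * y) = pi x * pi y.
Proof. exact: quotient_piM. Qed.

Lemma piZ c x : pi (c *: x) = c *: pi x.
Proof. exact: quotient_piZ. Qed.

Lemma pi_relation0 s : relations s -> pi s = 0.
Proof.
move=> Ss; rewrite -(raddf0 pi); apply/quotient_piP; rewrite subr0.
exact: sub_ideal_gen.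
Qed.

(** Only one arrow of each sign leaves a crossing, so a successor other than [next i] has the wrong
    sign. *)
Lemma pi_turn0 i j : src j = tgt i -> j != next i ->
  pi (elt (arrow_path j) * elt (arrow_path i)) = 0.
Proof.
move=> ji neq_ij; apply: pi_relation0; left; exists i, j; split=> //.
apply: contraNneq neq_ij => pij; by apply/eqP/source_positive_inj.
Qed.

Lemma pi_not_browsing p : ~~ browsing (path_arrows p) -> pi (elt p) = 0.
Proof.
case: p => -[v s] w.
change (~~ browsing s -> pi (elt (walk_path w)) = 0); move: w.
elim: s v => [//|a [//|b s] IH] v w.
have /andP[_ /andP[/eqP ba _]] := w.
have [w1 ->] := walk_path_cons k w.
rewrite /browsing [sorted _ _]/= negb_and; case: eqVneq => [_|neq_ab] /= bad.
  by rewrite piM IH ?mul0r.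
have [w2 ->] := walk_path_cons k w1.
by rewrite -mulrA piM pi_turn0 ?mulr0 // eq_sym.
Qed.

(** Type II, read in either direction since [tau] takes invertible values. *)
Lemma pi_circle_mate i j :
    src j = src i -> source_positive j != source_positive i ->
  exists c, pi (elt (strand i N)) = c *: pi (elt (strand j N)).
Proof.
have piE o u : src o = src u -> source_positive o -> ~~ source_positive u ->
    pi (elt (strand u N)) = tau (src o) *: pi (elt (strand o N)).
  move=> ou po pu; apply/eqP; rewrite -subr_eq0 -piZ -raddfB.
  rewrite -(type_II_strandE ou po pu); apply/eqP/pi_relation0; right.
  by exists (src o).
move=> ji; case pi : (source_positive i); case pj : (source_positive j) => // _.
- exists (tau (src i))^-1.
  by rewrite (piE i j) ?pj // scalerA mulVf // scale1r.
- by exists (tau (src j)); rewrite ?(piE j i) ?pi.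
Qed.

Lemma pi_strand_long i l : (N < l)%N -> pi (elt (strand i l)) = 0.
Proof.
move=> ltNl.
(* Split off the initial circle and the arrow [i] after it: once the circle is traded for that of
   the mate [j], the arrow [i] is a turn. *)
have lE : (l = N + (1 + (l - N.+1)))%N by rewrite addnA addn1 subnKC.
rewrite lE -strand_mul -strand_mul iter_next_size piM piM.
have [j [ji pj]] := crossing_mate i.
have [|c ->] := pi_circle_mate ji; first by rewrite pj; case: source_positive.
rewrite -quotient_scaleAr -mulrA -piM.
case: path_elt_mulP => [r _ _ ra _|_]; last first.
  by rewrite raddf0 mulr0 scaler0.
rewrite [pi (elt r)]pi_not_browsing ?mulr0 ?scaler0 // ra !strand_arrows.
rewrite -(prednK (passages_gt0 i)) /browsing fsorted_cat_traject.
rewrite prednK ?(passages_gt0 i) // iter_next_size.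
by apply/eqP => jE; rewrite jE in pj; case: source_positive pj.
Qed.

(* Up to a scalar, a strand of length 0 or [N] depends only on the crossing   *)
(* where it starts; it is counted at the over-passage of that crossing alone. *)
Definition basis_index (b : arrow Q * 'I_N.+1) : bool :=
  source_positive b.1 || (0 < b.2 < N)%N.

Definition basis_elt (b : arrow Q * 'I_N.+1) : Lambda :=
  pi (elt (strand b.1 b.2)).

Lemma pi_path_basis p : pi (elt p) = 0 \/
  exists b c, basis_index b /\ pi (elt p) = c *: basis_elt b.
Proof.
have [|/pi_not_browsing->] := boolP (browsing (path_arrows p)); last by left.
case s_p : (path_arrows p) => [|i s] s_browsing.
  have [o [_ [op _ po _]]] := over_under_arrows (path_src p).
  right; exists (o, ord0), 1; split; first by apply/orP; left.
  rewrite scale1r; congr (pi (elt _)); exact: path_eq.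
have {s s_p s_browsing} [l l_gt0 ->] : exists2 l, (0 < l)%N & p = strand i l.
  have /fpathP[n sE] : fpath next i s by [].
  exists n.+1 => //; apply: path_eq; last by rewrite s_p sE.
  by move: s_p (valP p); rewrite /path_arrows /path_src => -> /= /andP[/eqP].
case: (ltngtP l N) => [ltlN|ltNl|->]; last 2 first.
- by left; apply: pi_strand_long.
- right; case po : (source_positive i).
    exists (i, ord_max), 1; split; first by apply/orP; left.
    by rewrite scale1r.
  have [j [ji pj]] := crossing_mate i.
  have [|c ->] := pi_circle_mate ji; first by rewrite pj po.
  exists (j, ord_max), c; split=> //.
  by apply/orP; left; rewrite [_ (_, _).1]pj po.
- right; exists (i, Ordinal (ltnW ltlN : (l < N.+1)%N)), 1; split.
    by rewrite /basis_index /= l_gt0 ltlN orbT.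
  by rewrite scale1r.
Qed.

Lemma basis_span (x : Lambda) :
  exists a, x = \sum_(b | basis_index b) a b *: basis_elt b.
Proof.
rewrite -[x]quotient_reprK [quotient_repr x]path_eltE raddf_sum.
elim/big_ind: _ => [|_ _ [a ->] [b ->]|p _].
- by exists (fun=> 0); rewrite big1 // => b _; rewrite scale0r.
- exists (fun c => a c + b c); rewrite -big_split; apply: eq_bigr => c _.
  by rewrite scalerDl.
rewrite /= piZ; have [->|[b [c [bP ->]]]] := pi_path_basis p.
  exists (fun=> 0); rewrite scaler0 big1 // => b _; rewrite scale0r //.
exists (fun b' => if b' == b then monalg.mcoeff p (quotient_repr x) * c else 0).
rewrite (bigD1 b) //= eqxx scalerA big1 ?addr0 // => b' /andP[_ /negbTE->].
by rewrite scale0r.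
Qed.

(** * Complementary strands and nondegeneracy *)

(** The strand from the end of [b] that completes it to a full circle, of length N - l if [b] has
    length l. *)
Definition dual_index (b : arrow Q * 'I_N.+1) :=
  (iter b.2 next b.1, rev_ord b.2).

Lemma dual_indexK : involutive dual_index.
Proof.
move=> [i l]; rewrite /dual_index rev_ordK /= -iterD subSS.
by rewrite subnK ?iter_next_size // -ltnS.
Qed.

Lemma basis_dual_index b : basis_index b -> basis_index (dual_index b).
Proof.
case: b => i [l /= lN]; rewrite /basis_index /= subSS.
move=> /orP[pi|/andP[l0 ltlN]].
  case: (posnP l) => [->|l_gt0]; first by rewrite pi.
  move: lN; rewrite ltnS leq_eqVlt => /orP[/eqP->|ltlN].
    by rewrite iter_next_size pi.
  by rewrite subn_gt0 ltlN ltn_subrL l_gt0 (leq_trans _ ltlN) ?orbT.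
by rewrite subn_gt0 ltlN ltn_subrL l0 (leq_trans _ ltlN) ?orbT.
Qed.

Definition diagram_form : Lambda -> Lambda -> k :=
  functional_form circle_functional.

HB.instance Definition _ :=
  bilinear_isBilinear.Build k Lambda Lambda k *%R *%R diagram_form
    (functional_form_bilinear relations_circle_functional0).

Lemma diagram_form_basis b b' : basis_index b -> basis_index b' ->
  (diagram_form (basis_elt b) (basis_elt b') != 0)
    = (b' == dual_index b).
Proof.
case: b b' => i l [j m] iP jP.
have -> : diagram_form (basis_elt (i, l)) (basis_elt (j, m))
    = circle_functional (elt (strand i l) * elt (strand j m)).
  rewrite /diagram_form /functional_form /basis_elt -piM.
  exact: (quotient_functional_pi relations_circle_functional0).
rewrite circle_functional_elt2 strand_tgt strand_src !strand_arrows.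
apply/idP/eqP => [|[-> ->]].
  rewrite /circle_weight size_cat !size_traject.
  case: ifP => [/eqP ji|]; last by rewrite eqxx.
  case: ifP => [/andP[ij_browsing /eqP mlN] _|]; last by rewrite eqxx.
  congr pair; last by apply: val_inj; rewrite /= subSS -[LHS](addnK l) mlN.
  have {}ji : iter m next j = i.
    (* If one strand is trivial, browsing does not constrain the junction and only the crossings are
       known to agree; but then both indices are over-passages, hence equal. *)
    have {}iP : source_positive i || (0 < l < N)%N := iP.
    have {}jP : source_positive j || (0 < m < N)%N := jP.
    case: (posnP m) => [m0|m_gt0].
      move: mlN iP jP ji; rewrite m0 add0n => ->.
      rewrite ltnn andbF !orbF => pi pj ji.
      by apply: (source_positive_inj ji); rewrite [RHS]pi.
    case: (posnP l) => [l0|l_gt0].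
      move: mlN iP jP ji; rewrite l0 addn0 => ->.
      rewrite iter_next_size !ltnn andbF !orbF => pi pj ji.
      by apply: (source_positive_inj ji); rewrite [RHS]pi.
    move: ij_browsing; rewrite -(prednK m_gt0) -(prednK l_gt0).
    by rewrite /browsing fsorted_cat_traject => /eqP.
  by rewrite -ji -iterD addnC mlN iter_next_size.
have lN : (l <= N)%N by rewrite -ltnS.
have iE : iter (rev_ord l) next (iter l next i) = i.
  by rewrite /= subSS -iterD subnK ?iter_next_size.
rewrite iE eqxx -{2}iE -trajectD /= subSS subnK // circle_weight_circle.
exact: start_weight_neq0.
Qed.

Lemma diagram_form_nondegl x : (forall y, diagram_form x y = 0) -> x = 0.
Proof.
have [a ->] := basis_span x => form0; apply: big1 => b b_basis.
have := form0 (basis_elt (dual_index b)).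
rewrite linear_sumlz (bigD1 b) //= big1 ?addr0 => [|b' /andP[b'_basis neq_b]].
  rewrite linearZl_LR => /eqP; rewrite mulf_eq0 => /orP[/eqP->|/idPn[]].
    by rewrite scale0r.
  by rewrite diagram_form_basis ?basis_dual_index.
rewrite linearZl_LR; apply/eqP; rewrite mulf_eq0; apply/orP; right.
apply: contraNT neq_b; rewrite diagram_form_basis ?basis_dual_index //.
by rewrite (inj_eq (inv_inj dual_indexK)) eq_sym.
Qed.

Lemma diagram_form_nondegr y : (forall x, diagram_form x y = 0) -> y = 0.
Proof.
have [a ->] := basis_span y => form0; apply: big1 => b b_basis.
have := form0 (basis_elt (dual_index b)).
rewrite linear_sumr (bigD1 b) //= big1 ?addr0 => [|b' /andP[b'_basis neq_b]].
  rewrite linearZr_LR => /eqP; rewrite mulf_eq0 => /orP[/eqP->|/idPn[]].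
    by rewrite scale0r.
  by rewrite diagram_form_basis ?basis_dual_index // dual_indexK.
rewrite linearZr_LR; apply/eqP; rewrite mulf_eq0; apply/orP; right.
apply: contraNT neq_b; rewrite diagram_form_basis ?basis_dual_index //.
by rewrite dual_indexK.
Qed.

Lemma diagram_form_assoc x y z :
  diagram_form (x * y) z = diagram_form x (y * z).
Proof. by rewrite /diagram_form /functional_form mulrA. Qed.

End DiagramForm.

Theorem theorem3p3 (k : fieldType) (R : realType) (D : knot_diagram R)
    (D_crossing : (0 < #|vertex (diagram_quiver D)|)%N)
    (tau : vertex (diagram_quiver D) -> k) (tau_neq0 : forall e, tau e != 0) :
  exists f : {biscalar (diagram_algebra tau)},
    [/\ forall x, (forall y, f x y = 0) -> x = 0,
        forall y, (forall x, f x y = 0) -> y = 0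
      & forall x y z, f (x * y) z = f x (y * z)].
Proof.
exists (@diagram_form k R D tau); split.
- exact: diagram_form_nondegl.
- exact: diagram_form_nondegr.
- exact: diagram_form_assoc.
Qed.
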